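(* Assume that $\mathcal{G}_\nu$ and $\mathcal{G}_\tau$ are symmetric and positive definite on the relevant scalar function spaces. Let $(\bm{\gamma},V_\nu,V_\tau,r_{\mathrm g},r_{\mathrm m},\lambda_1,\dots,\lambda_K)$ be a sufficiently smooth solution of the continuous dual-SAV system (defined in the context), and suppose that $r_{\mathrm g}(t)\neq 0$ on the time interval under consideration. Then, on that time interval, $$\frac{\mathrm d}{\mathrm dt} r_{\mathrm g}^2(t) = -\mathcal{G}_\nu(V_\nu,V_\nu)\le 0,$$ $$\frac{\mathrm d}{\mathrm dt} r_{\mathrm m}^2(t) = -\mathcal{G}_\tau(V_\tau,V_\tau)\le 0.$$ In particular, the modified geometric SAV energy $r_{\mathrm g}^2$ and the modified mesh SAV energy $r_{\mathrm m}^2$ dissipate independently.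
   Context: Curves. $\mathbb{S}^1=\mathbb{R}/\mathbb{Z}$, and $\bm{\gamma}:\mathbb{S}^1\times[0,T)\to\mathbb{R}^2$ is a time-dependent regular smooth closed curve ($|\partial_\rho\bm{\gamma}|>0$, with enough smoothness for all quantities below to be defined), with initial curve $\bm{\gamma}_0=\bm{\gamma}(\cdot,0)$ and no topological changes. Arc length is given by $\mathrm ds=|\partial_\rho\bm{\gamma}|\,\mathrm d\rho$, the unit tangent is $\bm{\tau}=\partial_s\bm{\gamma}$, and $\bm{\nu}$ is the unit normal such that $(\bm{\tau},\bm{\nu})$ is a positively oriented orthonormal basis. The velocity is $\partial_t\bm{\gamma}=V_\nu\bm{\nu}+V_\tau\bm{\tau}$. $\mathbb{V}(\bm{\gamma})$ is a real scalar function space on $\bm{\gamma}$, sufficiently regular that all bilinear forms and $L^2$ pairings below are well-defined; $(u,v)_{L^2(\bm{\gamma})}=\int_{\bm{\gamma}}uv\,\mathrm ds$. (When the normal metric is the $H^{-1}$ metric, the normal velocity is taken in the zero-mean class $\{v\in L^2(\bm{\gamma}):\int_{\bm{\gamma}}v\,\mathrm ds=0\}$, which is then the relevant space for the normal equation.) Data. - $E_{\mathrm{geom}}(\bm{\gamma})$ is a geometric energy invariant under tangential reparametrization, with $L^2$-gradient $\nabla_{L^2}E_{\mathrm{geom}}=w_{\mathrm g}\bm{\nu}$ ($w_{\mathrm g}$ scalar). - $E_{\mathrm{mesh}}(\bm{\gamma})$ is an artificial, parametrization-dependent mesh regularization energy; only the tangential component of its driving force is used, and the corresponding scalar tangential force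 is $w_{\mathrm m}$. - $C_1,\dots,C_K$ are geometric constraint functionals with $\nabla_{L^2}C_i=g_i\bm{\nu}$ ($g_i$ scalar); the constraints are $C_i(\bm{\gamma})=0$. - $\mathcal{G}_\nu,\mathcal{G}_\tau:\mathbb{V}(\bm{\gamma})\times\mathbb{V}(\bm{\gamma})\to\mathbb{R}$ are (state-dependent) metric bilinear forms. - $S_{\mathrm g}(\bm{\gamma})=\sqrt{E_{\mathrm{geom}}(\bm{\gamma})+C_{\mathrm g}}$ and $S_{\mathrm m}(\bm{\gamma})=\sqrt{E_{\mathrm{mesh}}(\bm{\gamma})+C_{\mathrm m}}$, where $C_{\mathrm g},C_{\mathrm m}>0$ are fixed constants such that the radicands are positive. Continuous dual-SAV system. Find $\bm{\gamma}(t)$, scalar velocities $V_\nu,V_\tau\in\mathbb{V}(\bm{\gamma})$ (with $\partial_t\bm{\gamma}=V_\nu\bm{\nu}+V_\tau\bm{\tau}$), auxiliary variables $r_{\mathrm g}(t),r_{\mathrm m}(t)\in\mathbb{R}$ and Lagrange multipliers $\lambda_1(t),\dots,\lambda_K(t)\in\mathbb{R}$ such that for all $\varphi_\nu,\varphi_\tau\in\mathbb{V}(\bm{\gamma})$: $$\mathcal{G}_\nu(V_\nu,\varphi_\nu)=-\frac{r_{\mathrm g}(t)}{S_{\mathrm g}(\bm{\gamma})}(w_{\mathrm g},\varphi_\nu)_{L^2(\bm{\gamma})}-\sum_{i=1}^K\lambda_i(t)(g_i,\varphi_\nu)_{L^2(\bm{\gamma})},$$ $$\frac{\mathrm dr_{\mathrm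 g}}{\mathrm dt}(t)=\frac{1}{2S_{\mathrm g}(\bm{\gamma})}(w_{\mathrm g},V_\nu)_{L^2(\bm{\gamma})}+\sum_{i=1}^K\frac{\lambda_i(t)}{2r_{\mathrm g}(t)}(g_i,V_\nu)_{L^2(\bm{\gamma})},$$ $$\mathcal{G}_\tau(V_\tau,\varphi_\tau)=-\frac{r_{\mathrm m}(t)}{S_{\mathrm m}(\bm{\gamma})}(w_{\mathrm m},\varphi_\tau)_{L^2(\bm{\gamma})},$$ $$\frac{\mathrm dr_{\mathrm m}}{\mathrm dt}(t)=\frac{1}{2S_{\mathrm m}(\bm{\gamma})}(w_{\mathrm m},V_\tau)_{L^2(\bm{\gamma})},$$ $$\frac{\mathrm d}{\mathrm dt}C_i(\bm{\gamma})=(g_i,V_\nu)_{L^2(\bm{\gamma})}=0,\qquad i=1,\dots,K,$$ with initial conditions $\bm{\gamma}(\cdot,0)=\bm{\gamma}_0$, $r_{\mathrm g}(0)=S_{\mathrm g}(\bm{\gamma}_0)$, $r_{\mathrm m}(0)=S_{\mathrm m}(\bm{\gamma}_0)$. *)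

(* Defs.v *)
From HB Require Import structures.
From mathcomp Require Import all_boot all_order all_algebra.
From mathcomp Require Import all_classical all_reals all_analysis.

Set Implicit Arguments.
Unset Strict Implicit.
Unset Printing Implicit Defensive.

Import Order.TTheory GRing.Theory Num.Theory.
Import numFieldNormedType.Exports.

Local Open Scope classical_set_scope.
Local Open Scope ring_scope.

(* The circle is R/Z: a function on it is a 1-periodic function of rho. *)
Definition periodic1 (R : realType) (A : Type) (f : R -> A) : Prop :=
  forall rho, f (rho + 1) = f rho.

(* [k = Some m] is the class C^m, [k = None] is C^infinity. *)
Definition class_C (R : realType) (k : option nat) (f : R -> R) : Prop :=
  forall n : nat, (if k is Some m then (n <= m)%N else true) ->
    continuous (derive1n n f) /\
    ((if k is Some m then (n < m)%N else true) ->
     forall x, derivable (derive1n n f) x 1).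

Definition curve (R : realType) := R -> 'rV[R]_2.

(* The library's norm on ['rV[R]_2] is the maximum norm, whence [enorm]. *)
Definition dotv (R : realType) (u v : 'rV[R]_2) : R :=
  \sum_(i < 2) u ord0 i * v ord0 i.

Definition enorm (R : realType) (u : 'rV[R]_2) : R := Num.sqrt (dotv u u).

Definition speed (R : realType) (c : curve R) (rho : R) : R :=
  enorm (derive1 c rho).

Definition unit_tangent (R : realType) (c : curve R) (rho : R) : 'rV[R]_2 :=
  (speed c rho)^-1 *: derive1 c rho.

(* Counterclockwise rotation of the tangent by a right angle. *)
Definition unit_normal (R : realType) (c : curve R) (rho : R) : 'rV[R]_2 :=
  \row_(i < 2) (if i == ord0 then - unit_tangent c rho ord0 ord_max
                else unit_tangent c rho ord0 ord0).

Definition smooth_loop (R : realType) (k : option nat) (f : R -> 'rV[R]_2) :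
  Prop :=
  periodic1 f /\ forall i, class_C k (fun rho => f rho ord0 i).

Definition regular_closed_curve (R : realType) (k : option nat)
    (c : curve R) : Prop :=
  smooth_loop k c /\ forall rho, 0 < speed c rho.

Definition integral_ds (R : realType) (c : curve R) (f : R -> R) : R :=
  \int[lebesgue_measure]_(rho in `[0, 1]) (f rho * speed c rho).

Definition L2 (R : realType) (c : curve R) (v : R -> R) : Prop :=
  [/\ periodic1 v,
      measurable_fun (`[0, 1] : set R) v &
      lebesgue_measure.-integrable (`[0, 1] : set R)
        (EFin \o (fun rho => v rho ^+ 2 * speed c rho))].

Definition L2_inner (R : realType) (c : curve R) (u v : R -> R) : R :=
  integral_ds c (fun rho => u rho * v rho).

(* [G] represents the first variation of [E] at [c] in the L^2(ds) inner
   product of vector fields. *)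
Definition L2_gradient (R : realType) (E : curve R -> R) (c : curve R)
    (G : R -> 'rV[R]_2) : Prop :=
  (forall i, L2 c (fun rho => G rho ord0 i)) /\
  forall eta : R -> 'rV[R]_2, smooth_loop None eta ->
    is_derive (0 : R) 1 (fun eps : R => E (fun rho => c rho + eps *: eta rho))
      (integral_ds c (fun rho => dotv (G rho) (eta rho))).

Definition circle_diffeo (R : realType) (k : option nat) (phi : R -> R) :
  Prop :=
  [/\ class_C k phi, forall rho, phi (rho + 1) = phi rho + 1 &
      forall rho, 0 < derive1 phi rho].

Definition reparam_invariant (R : realType) (k : option nat)
    (E : curve R -> R) : Prop :=
  forall c phi, regular_closed_curve k c -> circle_diffeo k phi ->
    E (c \o phi) = E c.

Definition function_space (R : realType) (c : curve R) (V : set (R -> R)) :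
  Prop :=
  [/\ V `<=` L2 c, V (fun=> 0) &
      forall (a : R) u v, V u -> V v -> V (fun rho => a * u rho + v rho)].

Definition symmetric_on (R : realType) (V : set (R -> R))
    (G : (R -> R) -> (R -> R) -> R) : Prop :=
  forall u v, V u -> V v -> G u v = G v u.

Definition bilinear_on (R : realType) (V : set (R -> R))
    (G : (R -> R) -> (R -> R) -> R) : Prop :=
  (forall (a : R) u v w, V u -> V v -> V w ->
     G (fun rho => a * u rho + v rho) w = a * G u w + G v w) /\
  (forall (a : R) u v w, V u -> V v -> V w ->
     G w (fun rho => a * u rho + v rho) = a * G w u + G w v).

(* Elements of the function spaces are representatives, so a vanishing
   element is one that vanishes almost everywhere. *)
Definition positive_definite_on (R : realType) (V : set (R -> R))
    (G : (R -> R) -> (R -> R) -> R) : Prop :=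
  forall v, V v ->
    0 <= G v v /\
    (G v v = 0 -> {ae lebesgue_measure, forall rho, v rho = 0}).

(* Functionals, forces, spaces and metrics are total functions of the curve;
   [dual_SAV_data_ok] constrains them only on regular closed curves.
   [Vnu] and [Vtau] are the spaces of the normal and of the tangential
   equation: they may be equal, or [Vnu] may be the zero-mean class (as for an
   H^{-1} normal metric). *)
Record dual_SAV_data (R : realType) (K : nat) := DualSAVData {
  Egeom : curve R -> R;
  wgeom : curve R -> R -> R;
  Emesh : curve R -> R;
  Fmesh : curve R -> R -> 'rV[R]_2;
  Cons : 'I_K -> curve R -> R;
  gcons : 'I_K -> curve R -> R -> R;
  Vnu : curve R -> set (R -> R);
  Vtau : curve R -> set (R -> R);
  Gnu : curve R -> (R -> R) -> (R -> R) -> R;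
  Gtau : curve R -> (R -> R) -> (R -> R) -> R;
  Cg : R;
  Cm : R
}.

(* Only the tangential component of the mesh driving force is used. *)
Definition wmesh (R : realType) (K : nat) (D : dual_SAV_data R K)
    (c : curve R) (rho : R) : R :=
  dotv (Fmesh D c rho) (unit_tangent c rho).

Definition Sg (R : realType) (K : nat) (D : dual_SAV_data R K)
    (c : curve R) : R := Num.sqrt (Egeom D c + Cg D).

Definition Sm (R : realType) (K : nat) (D : dual_SAV_data R K)
    (c : curve R) : R := Num.sqrt (Emesh D c + Cm D).

Definition geometric_functional (R : realType) (k : option nat)
    (E : curve R -> R) (w : curve R -> R -> R) : Prop :=
  reparam_invariant k E /\
  forall c, regular_closed_curve k c ->
    L2 c (w c) /\ L2_gradient E c (fun rho => w c rho *: unit_normal c rho).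

Record dual_SAV_data_ok (R : realType) (K : nat) (k : option nat)
    (D : dual_SAV_data R K) : Prop := {
  ok_geom : geometric_functional k (Egeom D) (wgeom D);
  ok_mesh : forall c, regular_closed_curve k c ->
    L2 c (wmesh D c) /\ L2_gradient (Emesh D) c (Fmesh D c);
  ok_cons : forall i, geometric_functional k (Cons D i) (gcons D i);
  ok_Vnu : forall c, regular_closed_curve k c -> function_space c (Vnu D c);
  ok_Vtau : forall c, regular_closed_curve k c -> function_space c (Vtau D c);
  ok_Gnu : forall c, regular_closed_curve k c ->
    bilinear_on (Vnu D c) (Gnu D c);
  ok_Gtau : forall c, regular_closed_curve k c ->
    bilinear_on (Vtau D c) (Gtau D c);
  ok_Cg : 0 < Cg D;
  ok_Cm : 0 < Cm D
}.

(* Derivative at [t] of a function of time defined on [J]: two-sided in the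
   interior of [J], one-sided at an end point belonging to [J]. *)
Definition time_derivative (R : realType) (W : normedModType R) (J : set R)
    (f : R -> W) (t : R) (l : W) : Prop :=
  (fun s => (s - t)^-1 *: (f s - f t)) @ within J t^' --> l.

Record dual_SAV_solution (R : realType) (K : nat) (k : option nat)
    (D : dual_SAV_data R K) (gamma0 : curve R) (T : R)
    (gamma : R -> curve R) (vnu vtau : R -> R -> R) (rg rm : R -> R)
    (lambda : 'I_K -> R -> R) : Prop := {
  sol_regular : forall t : R, t \in `[0, T[ -> regular_closed_curve k (gamma t);
  sol_radicand_g : forall t : R, t \in `[0, T[ -> 0 < Egeom D (gamma t) + Cg D;
  sol_radicand_m : forall t : R, t \in `[0, T[ -> 0 < Emesh D (gamma t) + Cm D;
  sol_vnu : forall t : R, t \in `[0, T[ -> Vnu D (gamma t) (vnu t);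
  sol_vtau : forall t : R, t \in `[0, T[ -> Vtau D (gamma t) (vtau t);
  sol_velocity : forall t rho : R, t \in `[0, T[ ->
    time_derivative `[0, T[ (fun s => gamma s rho) t
      (vnu t rho *: unit_normal (gamma t) rho
       + vtau t rho *: unit_tangent (gamma t) rho);
  sol_normal : forall (t : R) phi, t \in `[0, T[ -> Vnu D (gamma t) phi ->
    Gnu D (gamma t) (vnu t) phi =
      - (rg t / Sg D (gamma t)) * L2_inner (gamma t) (wgeom D (gamma t)) phi
      - \sum_(i < K) lambda i t * L2_inner (gamma t) (gcons D i (gamma t)) phi;
  (* The right-hand side is meaningful only where [rg t] is nonzero. *)
  sol_rg : forall t : R, t \in `[0, T[ -> rg t != 0 ->
    time_derivative `[0, T[ (rg : R -> R^o) t
      ((2 * Sg D (gamma t))^-1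
         * L2_inner (gamma t) (wgeom D (gamma t)) (vnu t)
       + \sum_(i < K) lambda i t / (2 * rg t)
           * L2_inner (gamma t) (gcons D i (gamma t)) (vnu t));
  sol_tangential : forall (t : R) phi, t \in `[0, T[ -> Vtau D (gamma t) phi ->
    Gtau D (gamma t) (vtau t) phi =
      - (rm t / Sm D (gamma t)) * L2_inner (gamma t) (wmesh D (gamma t)) phi;
  sol_rm : forall t : R, t \in `[0, T[ ->
    time_derivative `[0, T[ (rm : R -> R^o) t
      ((2 * Sm D (gamma t))^-1
         * L2_inner (gamma t) (wmesh D (gamma t)) (vtau t));
  sol_cons : forall i (t : R), t \in `[0, T[ ->
    time_derivative `[0, T[ ((fun s => Cons D i (gamma s)) : R -> R^o) t
      (L2_inner (gamma t) (gcons D i (gamma t)) (vnu t)) /\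
    L2_inner (gamma t) (gcons D i (gamma t)) (vnu t) = 0;
  sol_gamma0 : gamma 0 = gamma0;
  sol_rg0 : rg 0 = Sg D gamma0;
  sol_rm0 : rm 0 = Sm D gamma0
}.

(* Main.v *)
Require Import Defs.
From HB Require Import structures.
From mathcomp Require Import all_boot all_order all_algebra.
From mathcomp Require Import all_classical all_reals all_analysis.
Import Order.TTheory GRing.Theory Num.Theory.
Import numFieldNormedType.Exports.
Local Open Scope classical_set_scope.
Local Open Scope ring_scope.

(** Each velocity is an admissible test function in its own equation. Taking [phi = vnu] in the
    normal equation, every multiplier term carries the factor [(g_i, vnu)], which is zero by the
    differentiated constraint; the same factor kills the multiplier terms in the equation for [rg].
    What is left gives [2 * rg * rg' = (rg / Sg) (w_g, vnu) = - Gnu vnu vnu], and positivity of the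
    metric gives the sign. The tangential pair works alike, without multipliers. Monotone decay then
    follows from the mean value theorem. The analytic input is the chain rule [time_derivative_sqr]
    and the sign criterion [time_derivative_le0_nincr], both for derivatives relative to a set, so
    that the initial time is covered. *)

Section TimeDerivative.
Context {R : realType}.
Implicit Types (J : set R) (f : R -> R) (t l : R).

Lemma cvg_sub_within_dnbhs J t :
  (fun s : R => s - t) @ within J t^' --> (0 : R).
Proof.
rewrite -(subrr t); apply: (@cvg_trans _ ((fun s : R => s - t) @ nbhs t)).
  by apply: cvg_app; apply: cvg_trans (@nbhs_dnbhs _ t); exact: cvg_within.
by apply: cvgB; [exact: cvg_id|exact: cvg_cst].
Qed.

Lemma time_derivative_cvg {J f t l} :
  time_derivative J (f : R -> R^o) t l -> f @ within J t^' --> f t.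
Proof.
move=> fl.
(* This identity also holds at [s = t], where the factor [s - t] vanishes. *)
have -> : f = fun s => f t + (s - t) * ((s - t)^-1 * (f s - f t)).
  apply/funext => s; have [->|st] := eqVneq s t.
    by rewrite !subrr mul0r addr0.
  by rewrite mulVKf ?subr_eq0// subrKC.
rewrite subrr mul0r -[X in _ --> X]/(f t + 0) -(mul0r l).
apply: cvgD; first exact: cvg_cst.
by apply: cvgM; [exact: cvg_sub_within_dnbhs|exact: fl].
Qed.

(** The difference quotient of the square is [f s + f t] times that of [f], and the first factor
    tends to [2 * f t] by continuity. *)
Lemma time_derivative_sqr {J f t l} :
  time_derivative J (f : R -> R^o) t l ->
  time_derivative J ((fun s => f s ^+ 2) : R -> R^o) t (2 * f t * l).
Proof.
move=> fl; rewrite /time_derivative.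
have -> : (fun s => (s - t)^-1 *: (f s ^+ 2 - f t ^+ 2 : R^o)) =
    fun s => (f s + f t) * ((s - t)^-1 * (f s - f t)).
  by apply/funext => s; rewrite subr_sqr [RHS]mulrC -mulrA.
apply: cvgM; last exact: fl.
rewrite mulr_natl mulr2n; apply: cvgD; last exact: cvg_cst.
exact: time_derivative_cvg fl.
Qed.

(** Near an interior point the restriction to [J] is vacuous, so the relative derivative is the
    ordinary two-sided one, as the mean value theorem requires. *)
Lemma time_derivative_is_derive {J f t l} :
  J° t -> time_derivative J (f : R -> R^o) t l -> is_derive t (1 : R) f l.
Proof.
move=> Jt fl.
suff fl' : (fun h : R => h^-1 *: (f (h *: (1 : R) + t) - f t : R^o)) @ 0^' --> l.
  by split; [apply/cvg_ex; exists l|exact: cvg_lim fl'].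
have shift : (fun h : R => h + t) @ 0^' --> within J t^'.
  have ht : (fun h : R => h + t) @ 0^' --> t.
    rewrite -[X in _ --> X]add0r; apply: cvgD; last exact: cvg_cst.
    exact: nbhs_dnbhs.
  move=> P PJ; change (\forall h \near 0^', P (h + t)).
  have JP : nbhs t (fun s => s != t -> J s -> P s) by exact: PJ.
  have := ht _ JP; have := ht _ Jt => HJ HP.
  near=> h; have h0 : h != 0 by near: h; exact: nbhs_dnbhs_neq.
  have Pht : h + t != t -> J (h + t) -> P (h + t) by near: h.
  apply: Pht; last by near: h.
  by rewrite -subr_eq0 addrK.
have := cvg_comp _ _ shift fl; apply: cvg_trans.
apply: near_eq_cvg; near=> h.
by rewrite /= addrK [h *: _]mulr1.
Unshelve. all: by end_near. Qed.

(** By the mean value theorem, [f b - f a] is [b - a] times a value of [l]. At [a] and [b] only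
    continuity is used, so one-sided derivatives suffice there. *)
Lemma time_derivative_le0_nincr {J f} (l : R -> R) {a b : R} : a <= b ->
  `[a, b]%classic `<=` J ->
  (forall t, `[a, b]%classic t -> time_derivative J (f : R -> R^o) t (l t) /\ l t <= 0) ->
  f b <= f a.
Proof.
rewrite le_eqVlt => /predU1P[->//|ab] abJ fl.
have oo_cc (t : R) : t \in `]a, b[ -> `[a, b]%classic t.
  by move=> tab; exact: subset_itv_oo_cc.
have fd (t : R) : t \in `]a, b[ -> is_derive t 1 f (l t).
  move=> tab; apply: time_derivative_is_derive (fl _ (oo_cc _ tab)).1.
  apply: (@filterS _ _ _ `]a, b[%classic); last exact: near_in_itvoo.
  by move=> x /oo_cc /abJ.
have fc : {within `[a, b], continuous f}.
  apply/subspace_continuousP => x xab P Pfx.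
  have fP : \forall s \near x, s != x -> J s -> P (f s).
    exact: (time_derivative_cvg (fl x xab).1 _ Pfx).
  change (\forall s \near x, `[a, b]%classic s -> P (f s)).
  (* The limit is over punctured neighbourhoods; the centre is added because [P] contains [f x]. *)
  apply: filterS fP => s Ps sab; have [->|sx] := eqVneq s x.
    exact: nbhs_singleton Pfx.
  by apply: Ps => //; exact: abJ.
have [c cab fE] := MVT ab fd fc.
rewrite -subr_le0 fE mulr_le0_ge0 ?subr_ge0 ?(ltW ab)//.
exact: (fl _ (oo_cc _ cab)).2.
Qed.

End TimeDerivative.

Theorem theorem4p1 (R : realType) (K : nat) (k : option nat)
  (D : dual_SAV_data R K) (gamma0 : curve R) (T : R)
  (gamma : R -> curve R) (vnu vtau : R -> R -> R) (rg rm : R -> R)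
  (lambda : 'I_K -> R -> R) (J : set R)
  (hk : k <> Some 0%N)
  (hD : dual_SAV_data_ok k D)
  (hGnu : forall c, regular_closed_curve k c ->
     symmetric_on (Vnu D c) (Gnu D c) /\
     positive_definite_on (Vnu D c) (Gnu D c))
  (hGtau : forall c, regular_closed_curve k c ->
     symmetric_on (Vtau D c) (Gtau D c) /\
     positive_definite_on (Vtau D c) (Gtau D c))
  (hT : 0 < T)
  (hsol : dual_SAV_solution k D gamma0 T gamma vnu vtau rg rm lambda)
  (hJ : is_interval J) (hJT : J `<=` `[0, T[)
  (hrg : forall t, J t -> rg t != 0) :
  (forall t, J t ->
     time_derivative `[0, T[ ((fun s => rg s ^+ 2) : R -> R^o) t
       (- Gnu D (gamma t) (vnu t) (vnu t)) /\
     - Gnu D (gamma t) (vnu t) (vnu t) <= 0) /\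
  (forall t, J t ->
     time_derivative `[0, T[ ((fun s => rm s ^+ 2) : R -> R^o) t
       (- Gtau D (gamma t) (vtau t) (vtau t)) /\
     - Gtau D (gamma t) (vtau t) (vtau t) <= 0) /\
  (forall s t, J s -> J t -> s <= t -> rg t ^+ 2 <= rg s ^+ 2) /\
  (forall s t, J s -> J t -> s <= t -> rm t ^+ 2 <= rm s ^+ 2).
Proof.
have JT t : J t -> t \in `[0, T[ by move=> /hJT.
have reg t : J t -> regular_closed_curve k (gamma t).
  by move=> /JT; exact: sol_regular hsol _.
have dg t : J t ->
    time_derivative `[0, T[ ((fun s => rg s ^+ 2) : R -> R^o) t
      (- Gnu D (gamma t) (vnu t) (vnu t)) /\
    - Gnu D (gamma t) (vnu t) (vnu t) <= 0.
  move=> Jt; have tT := JT _ Jt; have vV := sol_vnu hsol tT.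
  split; last by rewrite oppr_le0; exact: ((hGnu _ (reg _ Jt)).2 _ vV).1.
  have := time_derivative_sqr (sol_rg hsol tT (hrg _ Jt)).
  rewrite (sol_normal hsol tT vV).
  (* The constraint makes both multiplier sums vanish: the one in [rg'] and the one in the tested
     normal equation. *)
  rewrite !big1; [|by move=> i _; rewrite (sol_cons hsol i tT).2 mulr0..].
  by rewrite addr0 subr0 mulNr opprK invfM [2 * rg t]mulrC -!mulrA mulVKf.
have dm t : J t ->
    time_derivative `[0, T[ ((fun s => rm s ^+ 2) : R -> R^o) t
      (- Gtau D (gamma t) (vtau t) (vtau t)) /\
    - Gtau D (gamma t) (vtau t) (vtau t) <= 0.
  move=> Jt; have tT := JT _ Jt; have vV := sol_vtau hsol tT.
  split; last by rewrite oppr_le0; exact: ((hGtau _ (reg _ Jt)).2 _ vV).1.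
  have := time_derivative_sqr (sol_rm hsol tT).
  rewrite (sol_tangential hsol tT vV).
  by rewrite mulNr opprK invfM [2 * rm t]mulrC -!mulrA mulVKf.
have stJ s t : J s -> J t -> `[s, t] `<=` J.
  by move=> Js Jt x; rewrite /= in_itv /=; exact: hJ.
split=> //; split=> //; split=> s t Js Jt st.
  (* Derivatives are relative to the whole time interval; their sign is known only on the segment
     from [s] to [t], which lies in the interval [J]. *)
  have := time_derivative_le0_nincr (J := `[0, T[%classic)
    (f := fun s => rg s ^+ 2)
    (fun t => - Gnu D (gamma t) (vnu t) (vnu t)) st.
  apply; first exact: subset_trans (stJ _ _ Js Jt) hJT.
  by move=> x /(stJ _ _ Js Jt) /dg.
have := time_derivative_le0_nincr (J := `[0, T[%classic)
  (f := fun s => rm s ^+ 2)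
  (fun t => - Gtau D (gamma t) (vtau t) (vtau t)) st.
apply; first exact: subset_trans (stJ _ _ Js Jt) hJT.
by move=> x /(stJ _ _ Js Jt) /dm.
Qed.
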